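(* Let $\Omega\subset\mathbb C^n$ be a bounded domain and $F\subset\partial\Omega$ a closed set. Suppose that for every point $a\in\partial\Omega\setminus F$ there exist a neighborhood $U_a$ of $a$ and a negative plurisubharmonic function $\tilde u_a$ on $U_a\cap\Omega$ such that $$\lim_{z\to a}\tilde u_a(z)=0,\qquad \limsup_{z\to\xi}\tilde u_a(z)<0\quad\text{for all }\xi\in(\partial\Omega\cap U_a)\setminus\{a\}.$$ Assume that there exist a neighborhood $U$ of $F$ and a plurisubharmonic function $v$ on $U$ such that $$v<0\ \text{ on } U\cap\Omega,\qquad \lim_{z\to F}v(z)=0,\qquad \limsup_{z\to\xi}v(z)<0\quad\text{for all }\xi\in(\partial\Omega\cap U)\setminus F.$$ Then $\Omega$ is hyperconvex.
   Context: Neighborhoods are open in $\mathbb C^n$. All limits and upper limits at boundary points are taken over points $z$ of $\Omega$ (lying in the domain of definition of the function concerned); $\lim_{z\to F}v(z)=0$ means that $v(z)\to0$ as $z\in U\cap\Omega$ tends to $F$. A bounded domain $\Omega$ is hyperconvex if it admits a negative plurisubharmonic exhaustion function, i.e. a plurisubharmonic function $\varphi<0$ on $\Omega$ with $\varphi(z)\to0$ as $z\to\partial\Omega$. *)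

(* Defs.v *)
From mathcomp Require Export all_boot all_order all_algebra.
From mathcomp Require Export complex.
From mathcomp Require Export all_classical all_reals all_analysis.
Set Implicit Arguments.
Unset Strict Implicit.
Unset Printing Implicit Defensive.
Import Order.TTheory GRing.Theory Num.Theory numFieldNormedType.Exports.
Local Open Scope classical_set_scope.
Local Open Scope ring_scope.
Local Open Scope complex_scope.

(* C^(n+1).  The cast to numFieldType is what lets R[i] inherit the normed
   topology attached to every numFieldType.  The norm on row vectors is the
   maximum norm; it is used only for the topology and for boundedness. *)
Definition Cspace (R : realType) (n : nat) :=
  'rV[(R[i] : numFieldType)]_n.+1.

Definition boundary (T : topologicalType) (A : set T) : set T :=
  closure A `\` interior A.

Definition bounded_domain (R : realType) (n : nat) (D : set (Cspace R n)) :=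
  [/\ D !=set0, open D, connected D & bounded_set D].

(* Functions on a set D are represented by total functions of which only the
   values on D are constrained. *)
Definition usc_on (R : realType) (T : topologicalType)
    (D : set T) (u : T -> \bar R) :=
  forall x, D x -> forall c : R, (u x < c%:E)%E ->
    \forall y \near within D (nbhs x), (u y < c%:E)%E.

Definition circle_mean (R : realType) (u : R[i] -> \bar R)
    (c : R[i]) (r : R) : \bar R :=
  (((2 * pi)^-1)%R%:E *
   \int[lebesgue_measure]_(t in `[0%R, (2 * pi)%R])
     u (c + r%:C * (cos t +i* sin t))%R)%E.

(* Meant for open D; functions that are -oo on a component are allowed.
   The circle mean is an extended real < +oo: an upper semicontinuous u is
   measurable and bounded above on the circle. *)
Definition subharmonic (R : realType) (D : set (R[i] : numFieldType))
    (u : R[i] -> \bar R) :=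
  [/\ forall z, D z -> (u z < +oo)%E,
      usc_on D u &
      forall (c : R[i]) (r : R), 0 < r ->
        (forall z, `|z - c| <= r%:C -> D z) ->
        (u c <= circle_mean u c r)%E].

Definition plurisubharmonic (R : realType) (n : nat) (D : set (Cspace R n))
    (u : Cspace R n -> \bar R) :=
  [/\ forall z, D z -> (u z < +oo)%E,
      usc_on D u &
      forall a b : Cspace R n,
        subharmonic [set l : R[i] | D (a + l *: b)]
                    (fun l : R[i] => u (a + l *: b))].

(* set_nbhs F is the filter of sets that are neighborhoods of every point
   of F, so this says that u has limit 0 along D at each point of F. *)
Definition tends_to0_at (R : realType) (n : nat) (D F : set (Cspace R n))
    (u : Cspace R n -> \bar R) :=
  u z @[z --> within D (set_nbhs F)] --> 0%E.

Definition limsup_along (R : realType) (n : nat) (D : set (Cspace R n))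
    (u : Cspace R n -> \bar R) (x : Cspace R n) : \bar R :=
  limf_esup u (within D (nbhs x)).

Definition hyperconvex (R : realType) (n : nat) (D : set (Cspace R n)) :=
  bounded_domain D /\
  exists phi : Cspace R n -> \bar R,
    [/\ plurisubharmonic D phi,
        forall z, D z -> (phi z < 0)%E &
        tends_to0_at D (boundary D) phi].

(* Main.v *)
Require Import Defs.
From mathcomp Require Import measurable_realfun ring lra.
Import Order.TTheory GRing.Theory Num.Theory numFieldNormedType.Exports.
Local Open Scope classical_set_scope.
Local Open Scope ring_scope.
Local Open Scope complex_scope.

(** The exhaustion function is a Perron envelope.  Truncating a local peak
    function at a small negative level makes it constant near the edge of its
    neighborhood, so it extends by that constant to a plurisubharmonic function
    on Omega; after rescaling, every boundary point a has a barrier with values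
    in [-1, 0], equal to -1 on a fixed closed ball and tending to 0 at a.  The
    upper regularization phi of the supremum of all such functions is
    plurisubharmonic by Fatou's lemma, is negative by the maximum principle on
    the connected set Omega, and tends to 0 at the boundary because it lies
    between each barrier and 0.

    The extended function satisfies the sub-mean value inequality on small
    circles only.  To reach all circles, average it over the rotations by N-th
    roots of unity: by the maximum principle the value at the center is at most
    the average over some N equidistributed points of the circle, and N tends
    to infinity.

    In terms of h = -phi all integrands are nonnegative, so no integrability
    conditions arise. *)

Set Implicit Arguments.
Unset Strict Implicit.
Unset Printing Implicit Defensive.

(** * Lower semicontinuous functions and integrals over [[0, 2 * pi]] *)

(** The neighborhood is taken in the whole space, not relative to [D]. For open [D] this is the
    usual notion; for a closed disc it also controls points just outside. *)
Definition lsc_on {R : realType} {T : topologicalType} (D : set T)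
    (h : T -> R) :=
  forall x, D x -> forall c : R, c < h x -> \forall y \near x, c < h y.

Lemma lsc_measurable (R : realType) (g : R -> R) :
  lsc_on setT g -> measurable_fun setT (EFin \o g).
Proof.
move=> lg; apply: lower_semicontinuous_measurable => x a /=.
rewrite lte_fin => /(lg x I) [e /= e0 H].
exists (ball x e); first exact: nbhsx_ballx.
by move=> y /H; rewrite /= lte_fin.
Qed.

Lemma integral_cst2pi (R : realType) (m : R) :
  (\int[lebesgue_measure]_(t in `[0%R, (2 * pi)%R]) m%:E = (2 * pi * m)%:E :> \bar R)%E.
Proof.
rewrite (@integral_cst _ _ R lebesgue_measure) //=.
rewrite lebesgue_measure_itv /= lte_fin mulr_gt0 ?pi_gt0 //.
by rewrite sube0 -EFinM mulrC.
Qed.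

(** If [g 0] exceeded [m], then [g] would exceed some [c > m] on a short interval [[0, d]]; being at
    least [m] elsewhere, it would have an integral above [2 * pi * m]. *)
Lemma lsc_min_circle (R : realType) (g : R -> R) (m : R) :
  lsc_on setT g -> 0 <= m ->
  (forall t, m <= g t) ->
  (\int[lebesgue_measure]_(t in `[0%R, (2 * pi)%R]) (g t)%:E <=
     (2 * pi * m)%:E)%E -> g 0 <= m.
Proof.
move=> lg m0 mg int; rewrite leNgt; apply/negP => mlt.
move: int; apply/negP; rewrite -ltNge.
pose c := (m + g 0) / 2.
have mc : m < c by rewrite /c; lra.
have /(lg 0 I) : c < g 0 by rewrite /c; lra.
move=> [e /= e0 H].
have pi2 : (0 : R) < 2 * pi by rewrite mulr_gt0 ?pi_gt0.
(* The interval [[0, d]] has to fit both in the neighborhood of radius [e] and in the range of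
   integration. *)
pose d := Num.min (e / 2) (2 * pi).
have d0 : 0 < d by rewrite /d lt_min pi2 divr_gt0.
have dpi : d <= 2 * pi by rewrite /d ge_min lexx orbT.
have de : d < e by rewrite /d gt_min; apply/orP; left; lra.
apply: (@lt_le_trans _ _ (\int[lebesgue_measure]_(t in `[0%R, (2 * pi)%R])
   (m%:E + ((c - m) * \1_(`[0%R, d]%classic : set R) t)%:E))%E).
  rewrite ge0_integralD //; last 2 first.
  - by move=> x _; rewrite lee_fin mulr_ge0 ?subr_ge0 ?(ltW mc) // indicE ler0n.
  - apply/measurable_EFinP; apply: measurable_funM => //.
  rewrite integral_cst2pi; under [X in (_ + X)%E]eq_integral do rewrite EFinM.
  rewrite ge0_integralZl //; last 2 first.
  - exact/measurable_EFinP.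
  - by rewrite lee_fin subr_ge0 ltW.
  rewrite integral_indic // setIidl; last first.
    by move=> x /=; rewrite !in_itv /= => /andP[-> /=] xd; apply: le_trans xd dpi.
  rewrite /= lebesgue_measure_itv /= lte_fin d0 sube0 -EFinM -EFinD lte_fin ltrDl.
  by rewrite mulr_gt0 // subr_gt0.
apply: ge0_le_integral => //.
- move=> x _; rewrite -EFinD lee_fin addr_ge0 //.
  by rewrite mulr_ge0 ?subr_ge0 ?(ltW mc) // indicE ler0n.
- apply/measurable_EFinP; apply: measurable_funD => //; apply: measurable_funM => //.
- by apply: measurable_funTS; exact: lsc_measurable.
- move=> x _; rewrite -EFinD lee_fin indicE; case: (boolP (x \in _)) => [|_].
    rewrite inE /= in_itv /= => /andP[x0 xd].
    rewrite mulr1 subrKC; apply: ltW; apply: H => /=.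
    by rewrite sub0r normrN ger0_norm //; apply: le_lt_trans xd de.
  by rewrite mulr0 addr0.
Qed.

Lemma limn_einfE (R : realType) (u : nat -> \bar R) :
  limn_einf u = ereal_sup [set ereal_inf (u @` V) | V in \oo].
Proof. by rewrite -limf_einfE. Qed.

(** Fatou's lemma. The hypothesis with thresholds [c] says that [g] is at most the pointwise lower
    limit of [f n]. *)
Lemma fatou_le (R : realType) (f : nat -> R -> R) (g : R -> R) (M : R) :
  (forall n, measurable_fun setT (EFin \o f n)) -> (forall n t, 0 <= f n t) ->
  (forall t, 0 <= g t) -> measurable_fun setT (EFin \o g) ->
  (forall t, t \in `[0, 2 * pi] -> forall c, c < g t ->
     \forall n \near \oo, c <= f n t) ->
  (\forall n \near \oo,
     (\int[lebesgue_measure]_(t in `[0%R, (2 * pi)%R]) (f n t)%:E <= M%:E)%E) ->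
  (\int[lebesgue_measure]_(t in `[0%R, (2 * pi)%R]) (g t)%:E <= M%:E)%E.
Proof.
move=> mf f0 g0 mg fg fM.
pose I : set R := `[0%R, (2 * pi)%R]%classic.
have mI : measurable I by exact: measurable_itv.
have mfI n : measurable_fun I (fun t => (f n t)%:E).
  by apply: measurable_funTS; exact: mf.
have key := @fatou _ _ R lebesgue_measure I mI (fun n t => (f n t)%:E) mfI
  (fun n x _ => f0 n x).
apply: (@le_trans _ _ (limn_einf
    (fun n : nat => \int[lebesgue_measure]_(x in I) (f n x)%:E)%E)).
  apply: le_trans key; apply: ge0_le_integral => //.
  - by move=> x _; exact: g0.
  - exact: measurable_funTS.
  (* The lower limit is measurable as the negative of the upper limit of the negatives. *)
  - apply: (@eq_measurable_fun _ _ _ _ _ (fun t => - limn_esup (fun n => - (f n t)%:E))%E).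
      move=> t _ /=; rewrite -limn_einfN; congr limn_einf; apply/funext => n.
      by rewrite /= ?oppeK ?opprK.
    apply: measurableT_comp => //; apply: measurable_fun_limn_esup => n.
    exact: measurableT_comp.
  - move=> t It; rewrite limn_einfE.
    apply/lee_addgt0Pr => e e0.
    have /(fg t It) H : g t - e < g t by rewrite ltrBlDr ltrDl.
    rewrite -leeBlDr // -EFinB.
    apply: le_ereal_sup_tmp.
    exists (ereal_inf ((fun n => (f n t)%:E) @` [set n | g t - e <= f n t])).
      by eexists; first exact: H.
    by apply: le_ereal_inf_tmp => _ [n /= Hn <-]; rewrite lee_fin.
(* Every set of the filter at infinity contains an index whose integral is at most [M], which bounds
   the infimum over that set. *)
rewrite limn_einfE; apply: ge_ereal_sup => _ [V VF <-].
have [n [Vn Mn]] : exists n, V n /\ (\int[lebesgue_measure]_(x in I) (f n x)%:E <= M%:E)%E.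
  have /filter_ex [n [? ?]] : \oo (V `&`
      [set n | (\int[lebesgue_measure]_(x in I) (f n x)%:E <= M%:E)%E]).
    exact: filterI.
  by exists n.
by apply: ge_ereal_inf; exists (\int[lebesgue_measure]_(x in I) (f n x)%:E)%E => //; exists n.
Qed.

(** * Riemann sums of lower semicontinuous functions *)

Lemma grid_cell (R : realType) (q t : R) (m : nat) : (0 < m)%N ->
  0 <= t <= q * m%:R ->
  exists2 k, (k < m)%N & q * k%:R <= t <= q * k.+1%:R.
Proof.
elim: m => // m IH _ /andP[t0 tm].
have [le|lt] := leP (q * m%:R) t; first by exists m; rewrite ?ltnS // le.
have m0 : (0 < m)%N by rewrite lt0n; apply/eqP => m0; move: lt; rewrite m0; nra.
have [|k km Hk] := IH m0; first by rewrite t0 ltW.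
by exists k => //; exact: ltnW.
Qed.

(** Each Riemann sum is the integral of a step function [f n] sampled once per cell. Lower
    semicontinuity puts the step functions eventually above any [c < g t], and Fatou's lemma
    concludes. The offset [a] may vary with [N]. *)
Lemma riemann_sum_lsc (R : realType) (g : R -> R) (M : R) :
  lsc_on setT g -> (forall t, 0 <= g t) ->
  (forall N, (0 < N)%N -> exists2 a : R, 0 <= a <= 2 * pi / N%:R &
     \sum_(k < N) g (a + 2 * pi / N%:R * k%:R) <= N%:R * M) ->
  (\int[lebesgue_measure]_(t in `[0%R, (2 * pi)%R]) (g t)%:E <= (2 * pi * M)%:E)%E.
Proof.
move=> lg g0 H.
have pi2 : (0 : R) < 2 * pi by rewrite mulr_gt0 ?pi_gt0.
pose q (n : nat) : R := 2 * pi / n.+1%:R.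
have q0 n : 0 < q n by rewrite divr_gt0 // ltr0n.
have {H} /choice [a Ha] : forall n : nat, exists a : R, 0 <= a <= q n /\
    \sum_(k < n.+1) g (a + q n * k%:R) <= n.+1%:R * M.
  by move=> n; have [a ? ?] := H n.+1 erefl; exists a.
pose J n (k : nat) : set R := `[q n * k%:R, q n * k.+1%:R]%classic.
pose f n t := \sum_(k < n.+1) g (a n + q n * k%:R) * \1_(J n k) t.
have f0 n (k : 'I_n.+1) t : 0 <= g (a n + q n * k%:R) * \1_(J n k) t.
  by rewrite mulr_ge0 // indicE ler0n.
have mfk n (k : 'I_n.+1) : measurable_fun setT (fun t => g (a n + q n * k%:R) * \1_(J n k) t).
  by apply: measurable_funM => //; apply: measurable_indic; exact: measurable_itv.
apply: (@fatou_le _ f) => //.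
- by move=> n; apply/measurable_EFinP; apply: measurable_sum.
- by move=> n t; apply: sumr_ge0.
- exact: lsc_measurable.
- move=> t /[!in_itv] /= /andP[t0 t2] c cg.
  have [e /= e0 He] := lg t I c cg.
  near=> n.
  have qe : q n < e.
    rewrite /q mulrC -ltr_pdivlMr //.
    near: n; exact: near_infty_natSinv_lt (PosNum (divr_gt0 e0 pi2)).
  have [k kn /andP[k1 k2]] : exists2 k, (k < n.+1)%N & q n * k%:R <= t <= q n * k.+1%:R.
    by apply: grid_cell => //; rewrite t0 /q divfK // pnatr_eq0.
  (* Adjacent closed cells share an endpoint, where two terms are counted; only the lower bound by
     the [k]-th term is needed here. *)
  rewrite /f (bigD1 (Ordinal kn)) //= -[c]addr0 lerD //; last exact: sumr_ge0.
  rewrite indicE mem_set ?mulr1; last by rewrite /J /= in_itv /= k1.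
  apply: ltW; apply: He => /=.
  (* The sample point and [t] lie in the same cell, so they are at most [q n < e] apart. *)
  have [/andP[a1 a2] _] := Ha n.
  rewrite ltr_norml; apply/andP; split; move: k1 k2; rewrite -natr1; nra.
- apply: nearW => n.
  under eq_integral do rewrite /f -sumEFin.
  rewrite ge0_integral_sum //; last 2 first.
  + by move=> k; apply/measurable_EFinP; apply: measurable_funTS; exact: mfk.
  + by move=> k x _; rewrite lee_fin.
  have -> : (\sum_(k < n.+1) \int[lebesgue_measure]_(t in `[0%R, (2 * pi)%R])
      (g (a n + q n * k%:R) * \1_(J n k) t)%:E =
      \sum_(k < n.+1) (g (a n + q n * k%:R) * q n)%:E)%E.
    apply: eq_bigr => k _.
    under eq_integral do rewrite EFinM.
    rewrite ge0_integralZl //; last 2 first.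
    + by apply/measurable_EFinP; apply: measurable_indic; exact: measurable_itv.
    + by rewrite lee_fin.
    have mJ : measurable (J n k) by exact: measurable_itv.
    rewrite integral_indic // setIidl; last first.
      move=> x; rewrite /J /= !in_itv /= => /andP[x1 x2].
      rewrite (le_trans _ x1) ?(mulr_ge0 (ltW (q0 _))) //=.
      apply: le_trans x2 _; rewrite /q -mulrA -[leRHS]mulr1 ler_pM2l //.
      rewrite mulrC ler_pdivrMr ?ltr0n // mul1r ler_nat.
      exact: ltn_ord.
    rewrite /J /= lebesgue_measure_itv /= lte_fin ltr_pM2l // ltr_nat ltnSn.
    by rewrite -EFinB -EFinM -mulrBr -natrB // subSnn mulr1.
  rewrite sumEFin lee_fin -mulr_suml.
  have [_ HM] := Ha n.
  apply: le_trans (ler_wpM2r (ltW (q0 n)) HM) _.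
  by rewrite mulrAC /q mulrCA divff ?mulr1 // pnatr_eq0.
Unshelve. all: by end_near. Qed.

(** For [g] of period [2 * pi], the sum over [N] equidistributed points is periodic in its offset
    with period [2 * pi / N], so any nonnegative offset reduces to one inside the first cell. *)
Lemma riemann_sum_periodic (R : realType) (g : R -> R) (M : R) :
  lsc_on setT g -> (forall t, 0 <= g t) -> (forall t, g (t + 2 * pi) = g t) ->
  (forall N, (0 < N)%N -> exists2 a : R, 0 <= a &
     \sum_(k < N) g (a + 2 * pi / N%:R * k%:R) <= N%:R * M) ->
  (\int[lebesgue_measure]_(t in `[0%R, (2 * pi)%R]) (g t)%:E <= (2 * pi * M)%:E)%E.
Proof.
move=> lg g0 gper H; apply: riemann_sum_lsc => // -[//|N] _.
have [a a0 Ha] := H N.+1 erefl.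
set q := 2 * pi / N.+1%:R in Ha *.
have q0 : 0 < q by rewrite divr_gt0 ?ltr0n // mulr_gt0 ?pi_gt0.
pose G a := \sum_(k < N.+1) g (a + q * k%:R).
have GD b : G (b + q) = G b.
  (* Shifting by [q] drops the first term and appends one a full period later, which has the same
     value. *)
  rewrite /G big_ord_recr big_ord_recl /= mulr0 addr0 [RHS]addrC; congr (_ + _).
    apply: eq_bigr => i _; congr g.
    by rewrite /bump /= add1n -natr1; ring.
  rewrite -[RHS]gper; congr g; rewrite -addrA; congr (_ + _).
  by rewrite /q -natr1; field; rewrite ?natr1 ?nat1r pnatr_eq0.
have GM b m : G (b + q * m%:R) = G b.
  elim: m => [|m IH]; first by rewrite mulr0 addr0.
  by rewrite -IH -[RHS]GD -natr1; congr G; ring.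
have /truncn_itv : 0 <= a / q by rewrite divr_ge0 // ltW.
set m := Num.truncn _ => /andP[]; rewrite ler_pdivlMr // ltr_pdivrMr // -natr1 => m1 m2.
exists (a - q * m%:R); first by apply/andP; split; lra.
by rewrite -/(G _) -(GM _ m) subrK.
Qed.

(** * The complex modulus, the unit circle and compact sets *)

Local Notation C R := (R[i] : numFieldType).

(** Balls in [Cspace] have radii in [R[i]]; positivity in its partial order forces them to be
    real. *)
Lemma posc_real (R : realType) (e : R[i]) : 0 < e ->
  exists2 r : R, 0 < r & e = r%:C.
Proof.
move=> e0; have /complex_realP[r er] := gtr0_real e0.
by exists r => //; rewrite -ltcR -er.
Qed.

Lemma normc_le_ReIm (R : realType) (x y : R) :
  `|x +i* y : R[i]| <= (`|x| + `|y|)%:C.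
Proof.
rewrite normc_def /= lecR -[leRHS]ger0_norm ?addr_ge0 // -sqrtr_sqr ler_wsqrtr //.
by rewrite sqrrD !real_normK ?num_real //; have := mulr_ge0 (normr_ge0 x) (normr_ge0 y); lra.
Qed.

Lemma continuous_Complex (R : realType) :
  continuous (fun p : R * R => (p.1 +i* p.2 : C R)).
Proof.
move=> [x y]; apply/cvgrPdist_lt => e /posc_real[r r0 ->].
have r2 : 0 < r / 2 by rewrite divr_gt0.
near=> q.
apply: le_lt_trans (_ : `|(x - q.1) +i* (y - q.2) : R[i]| < _) => //.
apply: le_lt_trans (normc_le_ReIm _ _) _; rewrite ltcR.
have : `|x - q.1| < r / 2.
  near: q; have /cvgrPdist_lt : fst q @[q --> (x, y)] --> x by exact: cvg_fst.
  exact.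
have : `|y - q.2| < r / 2.
  near: q; have /cvgrPdist_lt : snd q @[q --> (x, y)] --> y by exact: cvg_snd.
  exact.
lra.
Unshelve. all: by end_near. Qed.

Definition cis {R : realType} (t : R) : C R := cos t +i* sin t.

Lemma continuous_cis (R : realType) : continuous (@cis R).
Proof.
move=> t.
apply: (@continuous2_cvg _ _ _ _ _ _ _ _ (fun x y : R => (x +i* y : C R))).
- exact: (@continuous_Complex R (cos t, sin t)).
- exact: continuous_cos.
- exact: continuous_sin.
Qed.

(** The norm of [R[i]] takes values in [R[i]]; this is the same modulus as an element of [R]. *)
Definition modc {R : realType} (z : C R) : R := complex.Re `|z|.

Lemma modcE (R : realType) (z : C R) : `|z| = (modc z)%:C.
Proof. by rewrite /modc RRe_real // normr_real. Qed.

Lemma normc_real (R : realType) (a : R) : `|a%:C| = (`|a|)%:C :> R[i].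
Proof. by rewrite normc_def /= expr0n /= addr0 sqrtr_sqr. Qed.

Lemma continuous_real_complex (R : realType) :
  continuous (fun r : R => r%:C : C R).
Proof.
move=> r A /nbhs_ballP[e /= /posc_real[d d0 ->] dA].
apply/nbhs_ballP; exists d => // s rs; apply: dA; move: rs.
by rewrite -!ball_normE /= -rmorphB normc_real ltcR.
Qed.

Lemma modc_lip (R : realType) (z w : C R) : `|modc z - modc w| <= modc (z - w).
Proof.
rewrite -lecR -modcE -normc_real rmorphB /= -!modcE.
exact: ler_dist_dist.
Qed.

Lemma continuous_modc (R : realType) : continuous (@modc R).
Proof.
move=> z A /nbhs_ballP[e /= e0 eA].
have e0' : 0 < (e%:C : R[i]) by rewrite ltcR.
have H : \forall w \near z, `|z - w| < e%:C.
  by apply/nbhs_ballP; exists e%:C => // w; rewrite -ball_normE.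
apply: filterS H => w; rewrite modcE ltcR => h; apply: eA.
by rewrite -ball_normE /=; apply: le_lt_trans h; exact: modc_lip.
Qed.

Lemma norm_cis (R : realType) (t : R) : `|cis t| = 1.
Proof. by rewrite normc_def /= cos2Dsin2 sqrtr1. Qed.

Lemma cis0 (R : realType) : cis (0 : R) = 1.
Proof. by rewrite /cis cos0 sin0. Qed.

Lemma cisD (R : realType) (s t : R) : cis (s + t) = cis s * cis t.
Proof. by apply/eqP; rewrite eq_complex /= cosD sinD [sin s * _ + _]addrC !eqxx. Qed.

Lemma cis2pi (R : realType) (t : R) : cis (t + 2 * pi) = cis t.
Proof.
by rewrite cisD [2 * pi]mulr_natl [cis (pi *+ 2)]/cis cos2pi sin2pi mulr1.
Qed.

(** The angle is [acos x] on the upper half circle and [2 * pi - acos x] on the lower one, which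
    keeps it nonnegative as [riemann_sum_periodic] requires. *)
Lemma cis_onto (R : realType) (z : C R) : `|z| = 1 -> exists2 t : R, 0 <= t & z = cis t.
Proof.
case: z => x y; rewrite normc_def /= => /complexI h.
have {}h : x ^+ 2 + y ^+ 2 = 1.
  by rewrite -(expr1n _ 2) -h sqr_sqrtr // addr_ge0 // sqr_ge0.
have x1 : -1 <= x <= 1 by apply/andP; split; nra.
have sy : sin (acos x) = `|y|.
  rewrite sin_acos //; have -> : 1 - x ^+ 2 = y ^+ 2 by rewrite -h; ring.
  by rewrite sqrtr_sqr.
have [y0|y0] := leP 0 y.
  exists (acos x); first exact: acos_ge0.
  by rewrite /cis acosK ?in_itv // sy ger0_norm.
exists (- acos x + 2 * pi).
  have := acos_lepi x1; have := @pi_ge0 R; lra.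
by rewrite cis2pi /cis cosN sinN acosK ?in_itv // sy ltr0_norm // opprK.
Qed.

Lemma closed_cdisc (R : realType) (M : R) :
  closed [set z : C R | `|z| <= M%:C].
Proof.
have -> : [set z : C R | `|z| <= M%:C] = @modc R @^-1` [set x | x <= M].
  by apply/seteqP; split => z /=; rewrite modcE lecR.
by apply: preimage_closed; [move=> z _; exact: continuous_modc|exact: closed_le].
Qed.

Lemma compact_cdisc (R : realType) (M : R) :
  compact [set z : C R | `|z| <= M%:C].
Proof.
have cB : compact ((fun p : R * R => (p.1 +i* p.2 : C R)) @`
    (`[-M, M]%classic `*` `[-M, M]%classic)).
  apply: continuous_compact.
    by apply: continuous_subspaceT; exact: continuous_Complex.
  by apply: compact_setX; exact: segment_compact.
apply: (subclosed_compact (@closed_cdisc R M) cB).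
move=> [x y] /=; rewrite normc_def lecR /= => h.
have xy : Num.sqrt (x ^+ 2) <= M /\ Num.sqrt (y ^+ 2) <= M.
  by split; apply: le_trans h; rewrite ler_wsqrtr // ?lerDl ?lerDr sqr_ge0.
exists (x, y) => //=; rewrite !in_itv /= -!ler_norml.
by move: xy; rewrite !sqrtr_sqr.
Qed.

Lemma compact_closure (R : realType) (n : nat) (A : set (Cspace R n)) :
  bounded_set A -> compact (closure A).
Proof.
move=> [M [Mreal normAltM]].
have /complex_realP[m Mm] := Mreal.
(* Boundedness bounds the norm on [A] by any number above [m], here [m + 1]; an open ball containing
   [A] then takes the larger radius [m + 2]. [B] is a polydisc, a product of compact discs. *)
pose B := [set v : Cspace R n | forall i, [set z : C R | `|z| <= (m + 2)%:C] (v ord0 i)].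
have cB : compact B.
  apply: (@rV_compact _ _ (fun=> [set z : C R | `|z| <= (m + 2)%:C])) => _.
  exact: compact_cdisc.
apply: (subclosed_compact _ cB); first exact: closed_closure.
have /closure_id -> : closed B by apply: compact_closed cB; exact: norm_hausdorff.
apply: closureS => v /normAltM normvleM i /=.
have vb : ball (0 : Cspace R n) ((m + 2)%:C : R[i]) v.
  rewrite -ball_normE /= sub0r normrN; apply: le_lt_trans (normvleM (m + 1)%:C _) _.
    by rewrite Mm ltcR ltrDl.
  by rewrite ltcR ltrD2l ltr1n.
case: vb => _ /(_ ord0 i); rewrite mxE -ball_normE /= sub0r normrN.
exact: ltW.
Qed.

(** * Operations on lower semicontinuous functions and their minima *)

Lemma lsc_on_comp (R : realType) (S T : topologicalType) (f : S -> T)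
    (D : set T) (h : T -> R) :
  continuous f -> lsc_on D h -> lsc_on (f @^-1` D) (h \o f).
Proof. by move=> cf lh x Dx c /(lh _ Dx) /cf. Qed.

Lemma lsc_on_cst (R : realType) (T : topologicalType) (D : set T) (c : R) :
  lsc_on D (fun=> c).
Proof. by move=> x _ d dc; apply: nearW => y; exact: dc. Qed.

Lemma lsc_on_add (R : realType) (T : topologicalType) (D : set T) (f g : T -> R) :
  lsc_on D f -> lsc_on D g -> lsc_on D (fun x => f x + g x).
Proof.
move=> lf lg x Dx c cfg; pose d := (f x + g x - c) / 2.
have d0 : 0 < d by rewrite /d; lra.
have Hf := lf x Dx (f x - d); have Hg := lg x Dx (g x - d).
near=> y.
have : f x - d < f y by near: y; apply: Hf; lra.
have : g x - d < g y by near: y; apply: Hg; lra.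
by rewrite /d; lra.
Unshelve. all: by end_near. Qed.

Lemma lsc_on_sum (R : realType) (T : topologicalType) (D : set T) (N : nat)
    (f : nat -> T -> R) :
  (forall k, lsc_on D (f k)) -> lsc_on D (fun x => \sum_(k < N) f k x).
Proof.
move=> lf; elim: N => [|N IH] x Dx c.
  by rewrite big_ord0 => c0; apply: nearW => y; rewrite big_ord0.
rewrite big_ord_recr /= => /(lsc_on_add IH (lf N) Dx).
by apply: filterS => y; rewrite big_ord_recr.
Qed.

(** If the infimum [m] were not attained, [f] would exceed [m] by a fixed amount near each point; by
    compactness one gap [e] would serve all of [K], contradicting the choice of [m]. *)
Lemma lsc_on_min (R : realType) (T : topologicalType) (K : set T) (f : T -> R) :
  compact K -> K !=set0 -> lsc_on K f -> (forall x, K x -> 0 <= f x) ->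
  exists2 x, K x & forall y, K y -> f x <= f y.
Proof.
move=> cK [x0 Kx0] lf f0.
have hi : has_inf (f @` K).
  by split; [exists (f x0), x0|exists 0 => _ [y Ky <-]; exact: f0].
set m := inf (f @` K).
have fm y : K y -> m <= f y by move=> Ky; apply: ge_inf; [case: hi|exists y].
apply: contrapT => nomin.
have mf x : K x -> m < f x.
  move=> Kx; rewrite lt_neqAle fm // andbT; apply/eqP => mE; apply: nomin.
  by exists x => // y Ky; rewrite -mE fm.
have near_gap : \forall e \near (0 : R)^'+, K `<=` (fun x => m + e < f x).
  move/compact_near_coveringP : cK; apply => x Kx.
  have mfx := mf x Kx; pose d := (f x - m) / 2.
  have d0 : 0 < d by rewrite /d; lra.
  have H : \forall y \near x, m + d < f y by apply: (lf x Kx); rewrite /d; lra.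
  near=> y e => /=; apply: lt_trans (_ : m + d < _); last by near: y.
  by rewrite ltrD2l; near: e; exact: nbhs_right_lt.
have /filter_ex [e [e0 He]] :
    \forall e \near (0 : R)^'+, 0 < e /\ K `<=` (fun x => m + e < f x).
  by near=> e; split; near: e; [exact: nbhs_right_gt|exact: near_gap].
have [_ [y Ky <-]] := inf_adherent e0 hi.
by rewrite -/m => /lt_trans /(_ (He y Ky)); rewrite ltxx.
Unshelve. all: by end_near. Qed.

(** * The super-mean value inequality and the minimum principle *)

Lemma continuous_line (K : numFieldType) (V : normedModType K) (z b : V) :
  continuous (fun l : K => z + l *: b).
Proof.
move=> l; apply: (@continuousD _ _ _ (fun=> z) (fun l : K => l *: b)).
- exact: cst_continuous.
- exact: scalel_continuous.
Qed.

(* The circle z + e^(it) b bounds a disc of the complex line through z with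
   direction b, so b carries both the direction and the radius. *)
Definition supermean {R : realType} {n : nat} (h : Cspace R n -> R)
    (z b : Cspace R n) :=
  (\int[lebesgue_measure]_(t in `[0%R, (2 * pi)%R]) (h (z + cis t *: b))%:E
    <= (2 * pi * h z)%:E)%E.

Definition supermean_on {R : realType} {n : nat} (D : set (Cspace R n))
    (h : Cspace R n -> R) :=
  forall z b, (forall l : C R, `|l| <= 1 -> D (z + l *: b)) -> supermean h z b.

Lemma circle_lsc (R : realType) (n : nat) (D : set (Cspace R n))
    (h : Cspace R n -> R) (z b : Cspace R n) :
  lsc_on D h -> (forall t : R, D (z + cis t *: b)) ->
  lsc_on setT (fun t : R => h (z + cis t *: b)).
Proof.
move=> lh Db t _ c.
have := @lsc_on_comp R _ _ (fun t : R => z + cis t *: b) D h _ lh t (Db t) c.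
apply => s; apply: (@continuous_comp _ _ _ cis (fun l : C R => z + l *: b)).
  exact: continuous_cis.
exact: continuous_line.
Qed.

Lemma min_circle (R : realType) (n : nat) (D : set (Cspace R n))
    (h : Cspace R n -> R) (z b : Cspace R n) m :
  lsc_on D h -> (forall t : R, D (z + cis t *: b)) -> 0 <= m ->
  (forall t : R, m <= h (z + cis t *: b)) ->
  (\int[lebesgue_measure]_(t in `[0%R, (2 * pi)%R]) (h (z + cis t *: b))%:E
    <= (2 * pi * m)%:E)%E ->
  h (z + b) <= m.
Proof.
move=> lh Db m0 mh hm.
have := lsc_min_circle (circle_lsc lh Db) m0 mh hm.
by rewrite cis0 scale1r.
Qed.

(** The direction is 1 or -1 according to the sign of the real part, and one choice serves every
    [r]. *)
Lemma away_from_origin (R : realType) (w : C R) :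
  exists2 s : C R, `|s| = 1 & forall r : R, 0 < r -> modc w < modc (w + r%:C * s).
Proof.
have key (x y s r : R) : 0 < r -> s = 1 /\ 0 <= x \/ s = -1 /\ x < 0 ->
    modc (x +i* y) < modc (x +i* y + r%:C * s%:C).
  move=> r0 Hs; rewrite /modc !normc_def /= ltr_sqrt; nra.
case: w => x y; have [x0|x0] := leP 0 x.
  by exists 1; [exact: normr1|move=> r r0; apply: (key x y 1); auto].
exists (-1); first by rewrite normrN normr1.
by move=> r r0; have := key x y (-1) r r0; rewrite rmorphN1; apply; right.
Qed.

Lemma near_right_scale (R : realType) (n : nat) (P : set (Cspace R n))
    (c : C R) (b : Cspace R n) :
  nbhs (0 : Cspace R n) P -> \forall r \near (0 : R)^'+, P ((r%:C * c) *: b).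
Proof.
move=> P0.
have cf : continuous (fun r : R => (0 : Cspace R n) + (r%:C : C R) *: (c *: b)).
  move=> r; apply: (@continuous_comp _ _ _ (fun r : R => (r%:C : C R))
    (fun l : C R => (0 : Cspace R n) + l *: (c *: b))).
    exact: continuous_real_complex.
  exact: continuous_line.
have H : \forall r \near (0 : R), P (0 + (r%:C : C R) *: (c *: b)).
  by apply: (cf 0 P); rewrite rmorph0 scale0r addr0.
suff : \forall r \near (0 : R), 0 < r -> P ((r%:C * c) *: b) by [].
by apply: filterS H => r + _; rewrite add0r scalerA.
Qed.

(** For fixed [N], the rotation sum [H] over the closed unit disc takes its minimum at some [cis a]
    on the circle. Comparison with the center gives [H (cis a) <= H 0 = N * h z], which is the
    sampling hypothesis of [riemann_sum_periodic]. *)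
Lemma local_supermean (R : realType) (n : nat) (D : set (Cspace R n))
    (h : Cspace R n -> R) :
  lsc_on D h -> (forall z, 0 <= h z) ->
  (forall z, D z -> \forall b \near (0 : Cspace R n), supermean h z b) ->
  supermean_on D h.
Proof.
move=> lh h0 loc z b Db.
have Dc (t : R) : D (z + cis t *: b) by apply: Db; rewrite norm_cis.
apply: riemann_sum_periodic.
- exact: circle_lsc lh Dc.
- by move=> t.
- by move=> t; rewrite cis2pi.
move=> N N0; set q := 2 * pi / N%:R.
pose H (l : C R) := \sum_(k < N) h (z + (l * cis (q * k%:R)) *: b).
pose K := [set l : C R | `|l| <= 1].
have Kw l (t : R) : K l -> K (l * cis t).
  by rewrite /K /= normrM norm_cis mulr1.
have lH : lsc_on K H.
  apply: (@lsc_on_sum R (C R) K N (fun k l => h (z + (l * cis (q * k%:R)) *: b))) => k l Kl c.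
  have := @lsc_on_comp R _ _ (fun l : C R => z + (l * cis (q * k%:R)) *: b) D h _ lh l _ c.
  apply; last by apply: Db; exact: Kw.
  rewrite (_ : (fun l0 : C R => _) = (fun l0 : C R => z + l0 *: (cis (q * k%:R) *: b))).
    exact: continuous_line.
  by apply/funext => x; rewrite scalerA.
have H0 l : 0 <= H l by apply: sumr_ge0.
have cK : compact K by exact: (@compact_cdisc R 1).
have K0 : K 0 by rewrite /K /= normr0 ler01.
have [l0 Kl0 minH] := lsc_on_min cK (ex_intro _ _ K0) lH (fun x _ => H0 x).
pose m := H l0.
pose Z := [set l | K l /\ H l <= m].
have cZ : compact Z.
  apply: (subclosed_compact _ cK) => [|l []//].
  rewrite -[Z]setCK; apply: open_closedC; rewrite openE => l nZ.
  have [Kl|nKl] := pselect (K l); last first.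
    have : open (~` K) by apply: closed_openC; exact: (@closed_cdisc R 1).
    by rewrite openE => /(_ l nKl); apply: filterS => l' ? [].
  have : m < H l by rewrite ltNge; apply/negP => ?; exact: nZ.
  by move=> /(lH l Kl); apply: filterS => l' /[swap] -[_ Hm]; rewrite ltNge Hm.
(* A minimum point of H farthest from 0 must lie on the unit circle: around an
   interior one, H would be constant on a small circle reaching farther out. *)
have [l1 [Kl1 Hl1] maxmod] : exists2 l, Z l & forall l', Z l' -> modc l' <= modc l.
  have [|||l Zl lmin] := @lsc_on_min R _ Z (fun l => 1 - modc l) cZ.
  - by exists l0; split => //; rewrite lexx.
  - move=> l _ c lc; have ml : modc l < 1 - c by lra.
    have ml_near : \forall l' \near l, modc l' < 1 - c by exact: continuous_modc (lt_nbhsl ml).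
    by apply: filterS ml_near => l' /=; lra.
  - by move=> l [+ _]; rewrite /K /= modcE lecR subr_ge0.
  by exists l => // l' /lmin; lra.
have l1_1 : `|l1| = 1.
  apply/eqP; rewrite eq_le [X in X && _]Kl1 /= real_leNgt ?normr_real //; apply/negP => l1lt.
  have [s s1 Hs] := away_from_origin l1.
  (* The radius [r] is small enough for the circle around [l1] to stay in the disc and for the local
     inequality to hold at all [N] rotated centers at once. *)
  have : \forall r \near (0 : R)^'+, 0 < r /\ r%:C <= 1 - `|l1| /\
     forall k : 'I_N, supermean h (z + (l1 * cis (q * k%:R)) *: b)
                                  ((r%:C * s * cis (q * k%:R)) *: b).
    near=> r; split; first by near: r; exact: nbhs_right_gt.
    split.
      rewrite modcE -(rmorphB (real_complex R) 1) lecR; near: r; apply: nbhs_right_le.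
      by rewrite subr_gt0 -ltcR -modcE.
    near: r; apply: filter_forall => k.
    have Dk : D (z + (l1 * cis (q * k%:R)) *: b) by apply: Db; apply: Kw.
    under eq_near do rewrite -mulrA.
    exact: (near_right_scale _ _ (loc _ Dk)).
  move=> /filter_ex [r [r0 [rl Hr]]].
  have K1 l : `|l| = 1 -> K (l1 + l * (r%:C * s)).
    move=> l_1; apply: le_trans (ler_normD _ _) _.
    have -> : `|l * (r%:C * s)| = r%:C.
      by rewrite !normrM l_1 s1 mul1r mulr1 ger0_norm // ler0c ltW.
    by rewrite addrC -lerBrDr.
  have := Hs r r0; rewrite ltNge => /negP; apply; apply: maxmod; split.
    by have := K1 1; rewrite normr1 mul1r; apply.
  have -> : r%:C * s = cis 0 * (r%:C * s) by rewrite cis0 mul1r.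
  pose zk (k : nat) := z + (l1 * cis (q * k%:R)) *: b.
  pose bk (k : nat) := (r%:C * s * cis (q * k%:R)) *: b.
  (* Along the small circle around [l1], [H] is a sum of [h] over [N] small circles, so the local
     inequalities add up to a mean of [H] of at most [H l1 <= m]. *)
  have HE t : H (l1 + cis t * (r%:C * s)) = \sum_(k < N) h (zk k + cis t *: bk k).
    by apply: eq_bigr => k _; rewrite /zk /bk mulrDl scalerDl addrA scalerA !mulrA.
  have lk k : lsc_on setT (fun t : R => h (zk k + cis t *: bk k)).
    apply: (circle_lsc lh) => t; rewrite /zk /bk scalerA -addrA -scalerDl !mulrA -mulrDl.
    by apply: Db; apply: Kw; rewrite -mulrA; apply: K1; rewrite norm_cis.
  apply: (@lsc_min_circle R (fun t => H (l1 + cis t * (r%:C * s)))).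
  - by rewrite (funext HE); exact: (@lsc_on_sum _ _ _ N (fun k t => h (zk k + cis t *: bk k))).
  - exact: H0.
  - by move=> t; apply: minH; apply: K1; rewrite norm_cis.
  - under eq_integral do rewrite HE -sumEFin.
    rewrite ge0_integral_sum //; last 2 first.
    + by move=> k; apply: measurable_funTS; exact: lsc_measurable.
    + by move=> k t _; rewrite lee_fin.
    apply: (@le_trans _ _ (\sum_(k < N) (2 * pi * h (zk k))%:E)%E).
      by apply: lee_sum => k _; exact: Hr.
    by rewrite sumEFin lee_fin -mulr_sumr ler_pM2l ?mulr_gt0 ?pi_gt0.
have [a a0 l1a] := cis_onto l1_1.
exists a => //.
have -> : N%:R * h z = H 0.
  rewrite /H; under eq_bigr do rewrite mul0r scale0r addr0.
  by rewrite sumr_const card_ord mulr_natl.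
apply: le_trans (minH _ K0); apply: le_trans Hl1.
rewrite /H l1a; apply: ler_sum => k _.
by rewrite cisD.
Unshelve. all: by end_near. Qed.

(** The zero set of [h] is relatively closed in [D] by lower semicontinuity and open by the mean
    value inequality, so connectedness would make it all of [D], against [0 < h z0]. *)
Lemma minimum_principle (R : realType) (n : nat) (D : set (Cspace R n))
    (h : Cspace R n -> R) (z0 : Cspace R n) :
  open D -> connected D -> lsc_on D h -> (forall z, 0 <= h z) ->
  supermean_on D h -> D z0 -> 0 < h z0 -> forall z, D z -> 0 < h z.
Proof.
move=> oD cD lh h0 mh Dz0 hz0 z1 Dz1; rewrite ltNge; apply/negP => hz1.
pose B := [set z | D z /\ h z <= 0].
suff BD : B = D by have [_] : B z0 by [rewrite BD]; rewrite leNgt hz0.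
apply: cD; first by exists z1.
- exists B; last by apply/seteqP; split => z [] //; case.
  rewrite openE => z [Dz hz].
  have : nbhs z D by apply: open_nbhs_nbhs.
  move=> /nbhs_ballP[e /= e0 eD].
  apply/nbhs_ballP; exists e => // w zw; split; first exact: eD.
  (* With direction [w - z], the circle around [z] passes through [w] at angle 0; as [h] has mean at
     most 0 on it, [h w <= 0]. *)
  have Db (l : C R) : `|l| <= 1 -> D (z + l *: (w - z)).
    move=> l1; apply: eD; move: zw; rewrite -!ball_normE /= opprD addNKr normrN normrZ.
    by move=> zw; apply: le_lt_trans zw; rewrite distrC ler_piMl.
  have Dc (t : R) : D (z + cis t *: (w - z)) by apply: Db; rewrite norm_cis.
  have := @min_circle R n D h z (w - z) 0 lh Dc (lexx _) (fun t => h0 _).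
  rewrite subrKC; apply; apply: le_trans (mh _ _ Db) _.
  by rewrite lee_fin ler_pM2l // mulr_gt0 ?pi_gt0.
- exists (~` [set z | D z /\ 0 < h z]).
    apply: open_closedC; rewrite openE => z [Dz hz].
    have Dn : \forall w \near z, D w by apply: open_nbhs_nbhs.
    by apply: filterS2 Dn (lh z Dz 0 hz) => w ? ?; split.
  apply/seteqP; split => z [Dz hz]; split=> //.
    by move=> [_]; rewrite ltNge hz.
  by rewrite leNgt; apply/negP => ?; exact: hz.
Qed.

(** * The regularized lower envelope *)

(* The lower semicontinuous regularization of the infimum of fam. *)
Definition lower_env {R : realType} {T : topologicalType} (fam : set (T -> R)) (z : T) :=
  sup [set m : R | \forall w \near z, forall f, fam f -> m <= f w].

Section LowerEnvelope.
Context (R : realType) (T : topologicalType) (fam : set (T -> R)).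
Hypothesis fam_ge0 : forall f z, fam f -> 0 <= f z.
Hypothesis fam_neq0 : fam !=set0.

Lemma lower_env_le f z : fam f -> lower_env fam z <= f z.
Proof.
move=> ff; apply: ge_sup; first by exists 0; apply: nearW => w g; exact: fam_ge0.
by move=> m /nbhs_singleton; exact.
Qed.

Lemma le_lower_env (m : R) (z : T) :
  (\forall w \near z, forall f, fam f -> m <= f w) -> m <= lower_env fam z.
Proof.
move=> mz; apply: ub_le_sup => //.
by have [f ff] := fam_neq0; exists (f z) => m' /nbhs_singleton; exact.
Qed.

Lemma lower_env_ge0 z : 0 <= lower_env fam z.
Proof. by apply: le_lower_env; apply: nearW => w f; exact: fam_ge0. Qed.

Lemma lower_env_lsc : lsc_on setT (lower_env fam).
Proof.
move=> z _ c /sup_gt[|m mz cm]; first by exists 0; apply: nearW => w g; exact: fam_ge0.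
have := near_join mz; apply: filterS => w /le_lower_env; exact: lt_le_trans.
Qed.

End LowerEnvelope.

Lemma continuous_shift (K : numFieldType) (V : normedModType K) (c : V) :
  continuous (fun v : V => v + c).
Proof.
move=> l; apply: (@continuousD _ _ _ (fun v : V => v) (fun=> c)) => //.
exact: cst_continuous.
Qed.

Lemma near_add_scale (K : numFieldType) (V : normedModType K) (D : set V)
    (z b : V) (l : K) : open D -> D (z + l *: b) ->
  \forall l' \near l & w \near z, D (w + l' *: b).
Proof.
move=> oD Dl.
have : nbhs (z + l *: b) D by apply: open_nbhs_nbhs.
move=> /nbhs_ballP[e /= e0 eD].
have e2 : 0 < e / 2 by rewrite divr_gt0.
have Hl : \forall l' \near l, ball (l *: b) (e / 2) (l' *: b).
  have := @scalel_continuous _ _ b l (ball (l *: b) (e / 2)).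
  by apply; exact: nbhsx_ballx.
near=> l' w; apply: eD.
have : ball z (e / 2) w by near: w; exact: nbhsx_ballx.
have : ball (l *: b) (e / 2) (l' *: b) by near: l'.
rewrite -!ball_normE /= => h1 h2.
by rewrite opprD addrACA [e]splitr; apply: le_lt_trans (ler_normD _ _) _; exact: ltrD.
Unshelve. all: by end_near. Qed.

(** The tube lemma for the compact unit disc. *)
Lemma near_disc (R : realType) (n : nat) (D : set (Cspace R n)) (z b : Cspace R n) :
  open D -> (forall l : C R, `|l| <= 1 -> D (z + l *: b)) ->
  \forall w \near z, forall l : C R, `|l| <= 1 -> D (w + l *: b).
Proof.
move=> oD Db.
pose K := [set l : C R | `|l| <= 1].
suff : \forall w \near z, K `<=` (fun l => D (w + l *: b)) by [].
have /compact_near_coveringP cK : compact K by exact: (@compact_cdisc R 1).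
apply: (cK _ (nbhs z) (fun w l => D (w + l *: b))) => l Kl.
by apply: near_add_scale => //; exact: Db.
Qed.

Lemma near_nat_inv_ball (R : realType) (n : nat) (z : Cspace R n)
    (P : set (Cspace R n)) (w : nat -> Cspace R n) :
  (forall j, ball z ((j.+1%:R^-1 : R)%:C) (w j)) -> nbhs z P ->
  \forall j \near \oo, P (w j).
Proof.
move=> zw /nbhs_ballP[e /= /posc_real[d d0 ->] dP].
have := near_infty_natSinv_lt (PosNum d0); apply: filterS => j /= jd.
by apply: dP; apply: le_ball (zw j); rewrite lecR ltW.
Qed.

(** Points [w j] tending to [z] and members of [fam] with values below [c] at [w j] exist for every
    [c] above the envelope at [z]. Each member bounds the envelope's mean around [w j] by [c]; lower
    semicontinuity and Fatou's lemma carry the bound to [z]. *)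
Lemma lower_env_supermean (R : realType) (n : nat) (D : set (Cspace R n))
    (fam : set (Cspace R n -> R)) :
  open D -> (forall f z, fam f -> 0 <= f z) -> fam !=set0 ->
  (forall f, fam f -> lsc_on D f) -> (forall f, fam f -> supermean_on D f) ->
  supermean_on D (lower_env fam).
Proof.
move=> oD f0 famN lf mf z b Db; set E := lower_env fam.
have pi2 : (0 : R) < 2 * pi by rewrite mulr_gt0 ?pi_gt0.
have E0 := lower_env_ge0 f0 famN.
have lE := lower_env_lsc f0 famN.
apply/lee_addgt0Pr => e e0; rewrite -EFinD.
(* This choice turns the slack [e] in the integral bound into a level strictly above [E z]. *)
pose c := E z + e / (2 * pi).
have -> : 2 * pi * E z + e = 2 * pi * c.
  by rewrite /c; move: (2 * pi) pi2 => p p0; field; rewrite gt_eqF.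
have Ec : E z < c by rewrite ltrDl divr_gt0.
have /choice[wf Hwf] : forall j : nat, exists p : Cspace R n * (Cspace R n -> R),
    [/\ ball z ((j.+1%:R^-1 : R)%:C) p.1, fam p.2 & p.2 p.1 < c].
  move=> j; apply: contrapT => H; move: Ec; rewrite ltNge => /negP; apply.
  apply: (le_lower_env famN); apply/nbhs_ballP; exists ((j.+1%:R^-1 : R)%:C) => /=.
    by rewrite ltcR invr_gt0 ltr0n.
  move=> w zw f ff; rewrite leNgt; apply/negP => fc; apply: H.
  by exists (w, f); split.
pose w j := (wf j).1.
have zw j : ball z ((j.+1%:R^-1 : R)%:C) (w j) by have [] := Hwf j.
have mE v : measurable_fun setT (EFin \o (fun t : R => E (v + cis t *: b))).
  by apply: lsc_measurable; apply: (circle_lsc lE).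
apply: (@fatou_le _ (fun j t => E (w j + cis t *: b))) => //.
- move=> t _ d dE.
  have H : \forall v \near z, d < E (v + cis t *: b).
    have cs : continuous (fun v : Cspace R n => v + cis t *: b).
      exact: continuous_shift.
    exact: (lsc_on_comp cs lE) dE.
  by apply: filterS (near_nat_inv_ball zw H) => j; exact: ltW.
- have H := near_nat_inv_ball zw (near_disc oD Db).
  apply: filterS H => j Dj.
  have [_ fj fc] := Hwf j.
  apply: (@le_trans _ _ (2 * pi * (wf j).2 (w j))%:E).
    apply: le_trans (mf _ fj _ _ Dj); apply: ge0_le_integral => //.
    + by move=> t _; exact: E0.
    + apply: measurable_funTS; exact: mE.
    + apply: measurable_funTS; apply: lsc_measurable; apply: (circle_lsc (lf _ fj)) => t.
      by apply: Dj; rewrite norm_cis.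
    + by move=> t _; rewrite lee_fin; exact: lower_env_le.
  by rewrite lee_fin ler_pM2l // ltW.
Qed.

(** * Tools for barriers: thickenings and means of plurisubharmonic functions *)

Lemma closure_thickening (K : numFieldType) (V : normedModType K) (E : set V) (r : K) :
  0 < r ->
  closure (\bigcup_(x in E) ball x (r / 2)) `<=` \bigcup_(x in E) ball x r.
Proof.
move=> r0 y /(_ (ball y (r / 2))) [|z [[x Ex xz] yz]].
  by apply: nbhsx_ballx; rewrite divr_gt0.
by exists x => //; exact: ball_splitl xz yz.
Qed.

Lemma compact_thickening (R : realType) (n : nat) (E W : set (Cspace R n)) :
  compact E -> open W -> E `<=` W ->
  exists2 r : R, 0 < r & \bigcup_(x in E) ball x r%:C `<=` W.
Proof.
move=> /compact_near_coveringP cE oW EW.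
have H : \forall r \near (0 : R)^'+, E `<=` (fun x => ball x r%:C `<=` W).
  apply: (cE _ ((0 : R)^'+) (fun r x => ball x r%:C `<=` W)) => x Ex.
  have /nbhs_ballP[e /= /posc_real[d d0 ->] dW] : nbhs x W.
    by apply: open_nbhs_nbhs; split => //; exact: EW.
  have d2 : 0 < d / 2 by rewrite divr_gt0.
  have Hx : \forall y \near x, ball x (d / 2)%:C y by apply: nbhsx_ballx; rewrite ltcR.
  near=> y r => /= w yw; apply: dW.
  have -> : d%:C = (d / 2)%:C + (d / 2)%:C by rewrite -rmorphD -splitr.
  have xy : ball x (d / 2)%:C y by near: y.
  apply: (ball_triangle xy); apply: le_ball yw; rewrite lecR.
  by near: r; apply: nbhs_right_le.
have /filter_ex[r [r0 rW]] :
    \forall r \near (0 : R)^'+, 0 < r /\ E `<=` (fun x => ball x r%:C `<=` W).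
  by near=> r; split; near: r; [exact: nbhs_right_gt|exact: H].
by exists r => // w [x Ex xw]; exact: rW Ex _ xw.
Unshelve. all: by end_near. Qed.

Lemma lte0_ltNfin (R : realType) (x : \bar R) : (x < 0)%E ->
  exists2 d : R, 0 < d & (x < (- d)%:E)%E.
Proof.
case: x => [r| |] //=; last by move=> _; exists 1 => //; exact: ltNyr.
rewrite lte_fin => r0; exists (- r / 2); first by rewrite divr_gt0 ?oppr_gt0.
by rewrite lte_fin; lra.
Qed.

(** This is the sub-mean inequality on the unit circle of the line through [z] with direction [b],
    with signs reversed so that the integrand is nonnegative. *)
Lemma plurisubharmonic_circle (R : realType) (n : nat) (D : set (Cspace R n))
    (u : Cspace R n -> \bar R) (z b : Cspace R n) :
  plurisubharmonic D u -> (forall z, D z -> (u z < 0)%E) ->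
  (forall l : C R, `|l| <= 1 -> D (z + l *: b)) ->
  (\int[lebesgue_measure]_(t in `[0%R, (2 * pi)%R]) (- u (z + cis t *: b)%R)
    <= (2 * pi)%:E * - u z)%E.
Proof.
move=> [_ _ /(_ z b) [_ _ /(_ 0 1 ltr01) sub]] u0 Db.
have pi2 : (0 : R) < 2 * pi by rewrite mulr_gt0 ?pi_gt0.
move: sub; rewrite scale0r addr0 /circle_mean.
have Dz (w : R[i]) : `|w - 0| <= 1%:C -> D (z + w *: b) by rewrite subr0; exact: Db.
move=> /(_ Dz).
under eq_integral do rewrite add0r mul1r -[u _]oppeK.
rewrite integral_ge0N; last first.
  by move=> t _; rewrite oppe_ge0 ltW // u0 //; apply: Db; rewrite norm_cis.
by rewrite muleN leeNr lee_pdivrMl.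
Qed.

Lemma usc_circle_measurable (R : realType) (n : nat) (D : set (Cspace R n))
    (u : Cspace R n -> \bar R) (z b : Cspace R n) :
  open D -> usc_on D u -> (forall t : R, D (z + cis t *: b)) ->
  measurable_fun setT (fun t : R => - u (z + cis t *: b)%R)%E.
Proof.
move=> oD uu Db; apply: lower_semicontinuous_measurable => t a.
have lteN_swap (x y : \bar R) : (x < - y)%E -> (y < - x)%E by rewrite lteNr.
move=> /lteN_swap ua; have H := uu (z + cis t *: b) (Db t) (- a) ua.
have H' : \forall w \near z + cis t *: b, (u w < (- a)%:E)%E.
  have Dn : \forall w \near z + cis t *: b, D w by apply: open_nbhs_nbhs.
  by apply: filterS2 Dn H => w Dw; apply.
exists (fun s => (u (z + cis s *: b)%R < (- a)%:E)%E); last first.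
  by move=> s; rewrite lteNr -EFinN.
have cz : continuous (fun s : R => z + cis s *: b).
  move=> s; apply: (@continuous_comp _ _ _ cis (fun l : C R => z + l *: b)).
    exact: continuous_cis.
  exact: continuous_line.
exact: cz H'.
Qed.

(** At a point where [h] reaches its upper bound 1 the inequality is trivial, so points of
    truncation need no further argument. *)
Lemma supermean_cst1 (R : realType) (n : nat) (h : Cspace R n -> R)
    (z b : Cspace R n) :
  (forall z, 0 <= h z <= 1) -> h z = 1 ->
  measurable_fun setT (fun t : R => (h (z + cis t *: b))%:E) -> supermean h z b.
Proof.
move=> h01 hz mh; rewrite /supermean hz -integral_cst2pi.
apply: ge0_le_integral => //.
- by move=> t _; rewrite lee_fin; have /andP[] := h01 (z + cis t *: b).
- exact: measurable_funTS.
- by move=> t _; rewrite lee_fin; have /andP[] := h01 (z + cis t *: b).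
Qed.

Lemma near0_disc (K : numFieldType) (V : normedModType K) (D : set V) (z : V) :
  nbhs z D ->
  \forall b \near (0 : V), forall l : K, `|l| <= 1 -> D (z + l *: b).
Proof.
move=> /nbhs_ballP[e /= e0 eD]; apply/nbhs_ballP; exists e => // b b0 l l1.
apply: eD; move: b0; rewrite -!ball_normE /= sub0r normrN opprD addNKr normrN normrZ.
by apply: le_lt_trans; rewrite ler_piMl.
Qed.

(** * Barriers by truncation; [E] stands for [F] or for a single boundary point *)

Section Barrier.
Context (R : realType) (n : nat) (Omega E V K : set (Cspace R n))
  (u : Cspace R n -> \bar R).
Hypotheses (Omega_dom : bounded_domain Omega) (E_closed : closed E)
  (E_bdry : E `<=` boundary Omega) (V_open : open V) (EV : E `<=` V)
  (u_psh : plurisubharmonic (V `&` Omega) u)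
  (u_lt0 : forall z, (V `&` Omega) z -> (u z < 0)%E)
  (u_peak : tends_to0_at (V `&` Omega) E u)
  (u_off : forall xi, ((boundary Omega `&` V) `\` E) xi ->
     (limsup_along (V `&` Omega) u xi < 0)%E)
  (K_closed : closed K) (KE : K `&` E = set0).

Let Omega_open : open Omega. Proof. by case: Omega_dom. Qed.

(** Inside [Omega] this is upper semicontinuity of [u]; at a boundary point off [E] it is the
    negative upper limit. *)
Lemma uniformly_negative_near (x : Cspace R n) : V x -> ~ E x -> closure Omega x ->
  exists2 d : R, 0 < d & \forall y \near x, Omega y -> (u y < (- d)%:E)%E.
Proof.
move=> Vx nEx cx.
have Vn : \forall y \near x, V y by apply: open_nbhs_nbhs.
have [Ox|nOx] := pselect (Omega x).
  have VOx : (V `&` Omega) x by [].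
  have [d d0 ud] := lte0_ltNfin (u_lt0 VOx).
  exists d => //; have [_ uu _] := u_psh.
  by apply: filterS2 Vn (uu x VOx _ ud) => y Vy H Oy; exact: H.
have /u_off : ((boundary Omega `&` V) `\` E) x.
  by split => //; split => //; split => // /interior_subset.
rewrite /limsup_along limf_esupE => /ereal_inf_lt[_ [A HA <-] /lte0_ltNfin[d d0 Ad]].
exists d => //; apply: filterS2 Vn HA => y Vy HAy Oy.
by apply: le_lt_trans Ad; apply: ereal_sup_ubound; exists y => //; exact: HAy.
Qed.

(* The truncation level -c is found by compactness of the part of the boundary
   of G in the closure of Omega. *)
Lemma exists_collar : exists G : set (Cspace R n), exists2 c : R, 0 < c &
  [/\ open G, E `<=` G, closure G `<=` V `\` K &
      forall x, closure G x -> ~ G x -> Omega x -> (u x < (- c)%:E)%E].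
Proof.
have [_ _ _ Ob] := Omega_dom.
have cO := compact_closure Ob.
have cE : compact E by apply: subclosed_compact E_closed cO _ => x /E_bdry[].
have oW : open (V `\` K) by apply: openI => //; exact: closed_openC.
have EW : E `<=` V `\` K.
  move=> x Ex; split; first exact: EV.
  by move=> Kx; have : (K `&` E) x by []; rewrite KE.
have [r r0 rW] := compact_thickening cE oW EW.
have r0' : 0 < (r%:C : C R) by rewrite ltcR.
(* Halving the radius keeps the closure of [G] inside the full thickening, hence inside [V] and off
   [K]. *)
pose G := \bigcup_(x in E) ball x ((r%:C : C R) / 2).
have oG : open G by apply: bigcup_open => x _; exact: ball_open.
have EG : E `<=` G by move=> x Ex; exists x => //; apply: ballxx; rewrite divr_gt0.
have cGW : closure G `<=` V `\` K.
  by apply: subset_trans rW; exact: closure_thickening.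
pose S := closure Omega `&` (closure G `&` ~` G).
have /compact_near_coveringP cS : compact S.
  apply: compact_closedI => //; apply: closedI; first exact: closed_closure.
  exact: open_closedC.
have H : \forall c \near (0 : R)^'+, S `<=` (fun x => Omega x -> (u x < (- c)%:E)%E).
  apply: (cS _ ((0 : R)^'+) (fun c x => Omega x -> (u x < (- c)%:E)%E)) => x [cOx [cGx nGx]].
  have [Vx _] := cGW _ cGx.
  have [d d0 dx] := uniformly_negative_near Vx (fun Ex => nGx (EG _ Ex)) cOx.
  near=> y c => /= Oy; apply: (@lt_le_trans _ _ (- d)%:E).
    by move: Oy; near: y.
  by rewrite lee_fin lerN2; near: c; exact: nbhs_right_le.
have /filter_ex[c [c0 cc]] : \forall c \near (0 : R)^'+,
    0 < c /\ S `<=` (fun x => Omega x -> (u x < (- c)%:E)%E).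
  by near=> c; split; near: c; [exact: nbhs_right_gt|exact: H].
exists G, c => //; split => // x cGx nGx Ox; apply: cc => //; split => //.
exact: subset_closure.
Unshelve. all: by end_near. Qed.

(** The barrier is the minimum of [- u / c] and 1 on [G], extended by 1. Since [u < - c] on the edge
    of [G] in [Omega], the pieces join lower semicontinuously. The mean inequality is checked on
    small circles and passed to [local_supermean]. *)
Lemma exists_barrier : exists h : Cspace R n -> R,
  [/\ forall z, 0 <= h z <= 1, lsc_on Omega h, supermean_on Omega h,
      forall z, K z -> h z = 1 &
      forall a, E a -> forall e : R, 0 < e -> \forall z \near a, Omega z -> h z < e].
Proof.
have [G [c c0 [oG EG cGW uG]]] := exists_collar.
have [_ u_usc _] := u_psh.
have GV x : G x -> V x by move=> /subset_closure/cGW[].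
(* Where [u] is [-oo] the minimum is 1, so [q] stays in [[0, 1]] on [G] and [fine] loses nothing. *)
pose q z := mine ((c^-1)%:E * - u z)%E 1%E.
pose h z := if `[< (G `&` Omega) z >] then fine (q z) else 1.
have q01 z : (G `&` Omega) z -> (0 <= q z <= 1)%E.
  move=> [Gz Oz]; rewrite /q ge_min lexx orbT andbT le_min lee01 andbT.
  rewrite mule_ge0 //; first by rewrite lee_fin invr_ge0 ltW.
  by rewrite oppe_ge0 ltW // u_lt0 //; split => //; exact: GV.
have qfin z : (G `&` Omega) z -> (fine (q z))%:E = q z.
  move=> /q01/andP[q0 q1]; rewrite fineK // ge0_fin_numE //.
  exact: le_lt_trans q1 (ltry _).
have hG z : (G `&` Omega) z -> (h z)%:E = q z.
  by move=> GO; rewrite /h asboolT // qfin.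
have hnG z : ~ G z -> h z = 1.
  by move=> nG; rewrite /h asboolF // => -[].
have h01 z : 0 <= h z <= 1.
  have [GO|nGO] := pselect ((G `&` Omega) z); last by rewrite /h asboolF // ler01 lexx.
  by have := q01 z GO; rewrite -hG // !lee_fin.
have oGO : open (G `&` Omega) by exact: openI.
have h_gt d z : (G `&` Omega) z -> (d < h z) = (d < 1) && (u z < (- (d * c))%:E)%E.
  move=> GO; rewrite -lte_fin hG // /q lt_min lte_fin andbC; congr (_ && _).
  by rewrite lte_pdivlMl // lteNr -EFinN mulrC.
have lh : lsc_on Omega h.
  move=> x Ox d dh.
  have On : \forall y \near x, Omega y by apply: open_nbhs_nbhs.
  have d1 : d < 1 by apply: lt_le_trans dh _; have /andP[] := h01 x.
  have [Gx|nGx] := pselect (G x).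
    have GOx : (G `&` Omega) x by [].
    have Gn : \forall y \near x, G y by apply: open_nbhs_nbhs.
    move: dh; rewrite h_gt // => /andP[_ ud].
    have VOx : (V `&` Omega) x by split => //; exact: GV.
    have un := u_usc x VOx _ ud.
    near=> y; have GOy : (G `&` Omega) y by split; near: y.
    rewrite h_gt // d1 /=.
    have : (V `&` Omega) y by split; [apply: GV; case: GOy|case: GOy].
    by near: y.
  (* At an edge point of [G], [u < - c] holds nearby in [V] and [Omega], so [h] exceeds every
     [d < 1] there on both sides of the edge. *)
  have [cGx|ncGx] := pselect (closure G x).
    have [Vx _] := cGW _ cGx.
    have un := u_usc x (conj Vx Ox) _ (uG x cGx nGx Ox).
    near=> y.
    have Oy : Omega y by near: y.
    have [Gy|/hnG -> //] := pselect (G y).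
    have uy : (u y < (- c)%:E)%E.
      by have : (V `&` Omega) y by [split => //; exact: GV]; near: y.
    rewrite h_gt // d1 /=; apply: lt_trans uy _.
    by rewrite lte_fin ltrN2 -[ltRHS]mul1r ltr_pM2r.
  have : \forall y \near x, (~` closure G) y.
    by apply: open_nbhs_nbhs; split => //; apply: closed_openC; exact: closed_closure.
  by apply: filterS => y ncGy; rewrite hnG // => /subset_closure.
exists h; split => //.
- apply: local_supermean => //; first by move=> z; have /andP[] := h01 z.
  move=> z Oz.
  have [hz1|hz1] := eqVneq (h z) 1.
    have Dn : nbhs z Omega by apply: open_nbhs_nbhs.
    have := near0_disc Dn; apply: filterS => b Db.
    apply: supermean_cst1 => //; apply: lsc_measurable; apply: (circle_lsc lh) => t.
    by apply: Db; rewrite norm_cis.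
  have Gz : G z by apply: contrapT => /hnG hz; move: hz1; rewrite hz eqxx.
  have GOz : (G `&` Omega) z by [].
  have Dn : nbhs z (G `&` Omega) by apply: open_nbhs_nbhs.
  have := near0_disc Dn; apply: filterS => b Db.
  have Dc (t : R) : (G `&` Omega) (z + cis t *: b) by apply: Db; rewrite norm_cis.
  have Vc (t : R) : (V `&` Omega) (z + cis t *: b) by have [/GV] := Dc t.
  (* On small circles [h] is at most [- u / c], with equality at the center because [h z] differs
     from 1; the inequality for [u] then suffices. *)
  have hu w : (G `&` Omega) w -> ((h w)%:E <= (c^-1)%:E * - u w)%E.
    by move=> GOw; rewrite hG // /q ge_min lexx.
  have hzE : (h z)%:E = ((c^-1)%:E * - u z)%E.
    move: hz1; rewrite -(inj_eq (@EFin_inj R)) hG // /q.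
    by rewrite minEle; case: ifP => //; rewrite eqxx.
  have mu : measurable_fun setT (fun t : R => - u (z + cis t *: b)%R)%E.
    by apply: usc_circle_measurable Vc => //; exact: openI.
  have u0 t : (0 <= - u (z + cis t *: b)%R)%E.
    by rewrite oppe_ge0 ltW // u_lt0 //; exact: Vc.
  apply: (@le_trans _ _ (\int[lebesgue_measure]_(t in `[0%R, (2 * pi)%R])
      ((c^-1)%:E * - u (z + cis t *: b)%R))%E).
    apply: ge0_le_integral => //.
    + by move=> t _; rewrite lee_fin; have /andP[] := h01 (z + cis t *: b).
    + apply: measurable_funTS; apply: lsc_measurable.
      by apply: (circle_lsc lh) => t; have [] := Dc t.
    + by apply: measurable_funTS; apply: emeasurable_funM => //; exact: measurable_cst.
    + by move=> t _; exact: hu.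
  rewrite ge0_integralZl //; last 2 first.
  + exact: measurable_funTS.
  + by rewrite lee_fin invr_ge0 ltW.
  rewrite EFinM hzE muleCA; apply: lee_wpmul2l; first by rewrite lee_fin invr_ge0 ltW.
  apply: plurisubharmonic_circle u_psh u_lt0 _ => l l1.
  by have [/GV] := Db l l1.
- by move=> z Kz; apply: hnG => /subset_closure/cGW[].
- move=> a Ea e e0.
  have Gn : \forall z \near a, G z by apply: open_nbhs_nbhs; split => //; exact: EG.
  have ec : ((- (e * c))%:E < (0 : \bar R))%E by rewrite lte_fin oppr_lt0 mulr_gt0.
  have : \forall z \near a, (V `&` Omega) z -> ((- (e * c))%:E < u z)%E.
    have H : within (V `&` Omega) (set_nbhs E) (fun z => ((- (e * c))%:E < u z)%E).
      exact: (u_peak (open_ereal_gt' ec)).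
    exact: (H a Ea).
  apply: filterS2 Gn => z Gz H Oz.
  have GO : (G `&` Omega) z by [].
  rewrite -lte_fin hG // /q gt_min; apply/orP; left.
  rewrite lte_pdivrMl // lteNl -EFinN mulrC; apply: H; split => //; exact: GV.
Unshelve. all: by end_near. Qed.

End Barrier.

(** * Return to plurisubharmonic functions *)

Lemma plurisubharmonic_opp (R : realType) (n : nat) (D : set (Cspace R n))
    (h : Cspace R n -> R) :
  lsc_on setT h -> (forall z, 0 <= h z) -> supermean_on D h ->
  plurisubharmonic D (fun z => (- h z)%:E).
Proof.
move=> lh h0 mh.
have pi2 : (0 : R) < 2 * pi by rewrite mulr_gt0 ?pi_gt0.
split=> [z _|x Dx c|a b]; first exact: ltry.
  rewrite lte_fin ltrNl => /(lh x I) H.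
  by apply: cvg_within; apply: filterS H => y; rewrite lte_fin ltrNl.
split=> [z _|x Dx c|c r r0 Dr]; first exact: ltry.
  rewrite lte_fin ltrNl => H.
  have H' := @lsc_on_comp R _ _ (fun l : C R => a + l *: b) setT h
    (@continuous_line _ _ a b) lh x I _ H.
  by apply: cvg_within; apply: filterS H' => y; rewrite lte_fin ltrNl.
(* The circle of center [c] and radius [r] on the line [a + l *: b] is the one centered at
   [a + c *: b] with direction [r%:C *: b]. *)
have Db (l : C R) : `|l| <= 1 -> D (a + c *: b + l *: (r%:C *: b)).
  move=> l1; rewrite scalerA -addrA -scalerDl; apply: Dr.
  by rewrite addrC addKr normrM normc_real (gtr0_norm r0) ler_piMl // ler0c ltW.
rewrite /circle_mean; under eq_integral do rewrite EFinN.
rewrite integral_ge0N; last by move=> t _; rewrite lee_fin.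
rewrite EFinN muleN leeN2 lee_pdivrMl // -EFinM.
apply: le_trans (mh _ _ Db); rewrite le_eqVlt; apply/orP; left; apply/eqP.
apply: eq_integral => t _; congr (h _)%:E.
by rewrite scalerA -addrA -scalerDl [r%:C * _]mulrC.
Qed.

Lemma sub_usc_on (R : realType) (T : topologicalType) (D D' : set T)
    (u : T -> \bar R) : D' `<=` D -> usc_on D u -> usc_on D' u.
Proof.
move=> sD uu x Dx c ux.
have H : nbhs x [set y | D y -> (u y < c%:E)%E] by exact: (uu x (sD _ Dx) c ux).
suff : nbhs x [set y | D' y -> (u y < c%:E)%E] by [].
by apply: filterS H => y H /sD.
Qed.

Lemma sub_plurisubharmonic (R : realType) (n : nat) (D D' : set (Cspace R n))
    (u : Cspace R n -> \bar R) :
  D' `<=` D -> plurisubharmonic D u -> plurisubharmonic D' u.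
Proof.
move=> sD [u1 u2 u3]; split; [by move=> z /sD; exact: u1|exact: sub_usc_on u2|].
move=> a b; have [s1 s2 s3] := u3 a b.
split; [by move=> z /sD; exact: s1|by apply: sub_usc_on s2 => l /sD|].
by move=> c r r0 Dr; apply: s3 => // z /Dr/sD.
Qed.

(** * The Perron envelope as exhaustion function *)

Unset Implicit Arguments.
Local Close Scope complex_scope.

Theorem proposition2p2 (R : realType) (n : nat) (Omega F : set (Cspace R n))
  (Omega_dom : bounded_domain Omega)
  (F_closed : closed F) (F_bdry : F `<=` boundary Omega)
  (local_peak : forall a, (boundary Omega `\` F) a ->
     exists (Ua : set (Cspace R n)) (ua : Cspace R n -> \bar R),
       [/\ open Ua /\ Ua a,
           plurisubharmonic (Ua `&` Omega) ua,
           forall z, (Ua `&` Omega) z -> (ua z < 0)%E,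
           tends_to0_at (Ua `&` Omega) [set a] ua &
           forall xi, ((boundary Omega `&` Ua) `\ a) xi ->
             (limsup_along (Ua `&` Omega) ua xi < 0)%E])
  (peak_along_F : exists (U : set (Cspace R n)) (v : Cspace R n -> \bar R),
       [/\ open U /\ F `<=` U,
           plurisubharmonic U v,
           forall z, (U `&` Omega) z -> (v z < 0)%E,
           tends_to0_at (U `&` Omega) F v &
           forall xi, ((boundary Omega `&` U) `\` F) xi ->
             (limsup_along (U `&` Omega) v xi < 0)%E]) :
  hyperconvex Omega.
Proof.
have [[x0 Ox0] oO cO bO] := Omega_dom.
have bdryNO x : boundary Omega x -> ~ Omega x.
  by move=> [_ nO] Ox; apply: nO; move: oO; rewrite openE; exact.
have /nbhs_ballP[e /= e0 eO] : nbhs x0 Omega by apply: open_nbhs_nbhs.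
(* Written as a thickening of one point, the ball of radius [e / 2] has its closure in the ball of
   radius [e] by [closure_thickening], hence in [Omega]. *)
pose B := \bigcup_(x in [set x0]) ball x (e / 2).
pose K := closure B.
have KO : K `<=` Omega.
  by move=> y /(closure_thickening e0)[_ -> ]; exact: eO.
have KE (E : set (Cspace R n)) : E `<=` boundary Omega -> K `&` E = set0.
  by move=> Eb; apply/seteqP; split => // y [/KO Oy /Eb /bdryNO].
have cK : closed K by exact: closed_closure.
(* At points of [F] the barrier comes from [v] with [E = F]; at any other boundary point it comes
   from the local peak function with [E = [set a]]. *)
have barrier a : boundary Omega a -> exists h : Cspace R n -> R,
  [/\ forall z, 0 <= h z <= 1, lsc_on Omega h, supermean_on Omega h,
      forall z, K z -> h z = 1 &
      forall e : R, 0 < e -> \forall z \near a, Omega z -> h z < e].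
  move=> ba; have [Fa|nFa] := pselect (F a).
    have [U [v [[oU FU] v_psh v0 v_peak v_off]]] := peak_along_F.
    have v_psh' : plurisubharmonic (U `&` Omega) v.
      by apply: sub_plurisubharmonic v_psh => z [].
    have [h [h01 lh mh hK hF]] := exists_barrier Omega_dom F_closed F_bdry
      oU FU v_psh' v0 v_peak v_off cK (KE _ F_bdry).
    by exists h; split => //; exact: hF.
  have [U [u [[oU Ua] u_psh u0 u_peak u_off]]] := local_peak a (conj ba nFa).
  have aU : [set a] `<=` U by move=> _ ->.
  have ab : [set a] `<=` boundary Omega by move=> _ ->.
  have ca : closed [set a].
    apply: accessible_closed_set1; apply: hausdorff_accessible.
    exact: norm_hausdorff.
  have [h [h01 lh mh hK hF]] := exists_barrier Omega_dom ca ab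
    oU aU u_psh u0 u_peak u_off cK (KE _ ab).
  by exists h; split => //; exact: hF.
(* No boundary condition is imposed, so this one family contains the barriers of all boundary
   points. *)
pose fam := [set h : Cspace R n -> R |
  [/\ forall z, 0 <= h z <= 1, lsc_on Omega h, supermean_on Omega h &
      forall z, K z -> h z = 1]].
have fam_ge0 f z : fam f -> 0 <= f z by move=> [/(_ z)/andP[]].
have fam_neq0 : fam !=set0.
  have l1 := @lsc_on_cst R _ Omega 1.
  have c01 (z : Cspace R n) : 0 <= (1 : R) <= 1 by rewrite ler01 lexx.
  exists (fun=> 1); split => //.
  by move=> z b _; apply: supermean_cst1.
pose h := lower_env fam.
have h0 : forall z, 0 <= h z by exact: lower_env_ge0.
have lh : lsc_on setT h by exact: lower_env_lsc.
have mh : supermean_on Omega h.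
  by apply: lower_env_supermean => // f [].
have lhO : lsc_on Omega h by move=> x _; exact: lh.
(* All members equal 1 on a ball around [x0], so the regularized infimum is at least 1 at [x0]; the
   minimum principle spreads positivity over [Omega]. *)
have hx0 : 0 < h x0.
  apply: (lt_le_trans ltr01); apply: le_lower_env => //.
  apply/nbhs_ballP; exists (e / 2) => /=; first by rewrite divr_gt0.
  move=> w x0w f [_ _ _ fK]; rewrite fK //; apply: subset_closure.
  by exists x0.
have h_gt0 := minimum_principle oO cO lhO h0 mh Ox0 hx0.
split=> //; exists (fun z => (- h z)%:E); split.
- exact: plurisubharmonic_opp.
- by move=> z Oz; rewrite lte_fin oppr_lt0 h_gt0.
(* Near each boundary point [h] is squeezed between 0 and the barrier of that point. *)
- have H : (- h z) @[z --> within Omega (set_nbhs (boundary Omega))] --> (0 : R).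
    apply/cvgrPdist_lt => d d0; rewrite /within /= => a ba.
    have [f [f01 lf mf fK fa]] := barrier a ba.
    have ff : fam f by [].
    have := fa d d0; apply: filterS => z H Oz.
    rewrite sub0r opprK (ger0_norm (h0 z)).
    by apply: le_lt_trans (H Oz); exact: lower_env_le.
  by apply: cvg_EFin; [exact: nearW|exact: H].
Qed.
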